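(* There exists a non-negative sequence $\lambda=(\lambda_{IJ})_{I,J\in\mathcal{D}}$ which is not in product $\mathrm{BMO}$ (in fact, not even in rectangular $\mathrm{BMO}$), i.e. $\|\lambda\|_{\mathrm{BMO}_{\mathrm{prod}}}=\infty$ and $\|\lambda\|_{\mathrm{BMO}_{\mathrm{rec}}}=\infty$, but nevertheless $\|P_\lambda\|_{2\to2}<\infty$. So, product $\mathrm{BMO}$ is not necessary for the unconditional boundedness of $P_\lambda$.
   Context: Functions are real-valued, and $\mathcal{D}$ is the standard dyadic grid in $\mathbb{R}$, i.e. the collection of intervals $[k2^{-i},(k+1)2^{-i})$, $i,k\in\mathbb{Z}$. Letters $I,J$ always denote elements of $\mathcal{D}$. For $I\in\mathcal{D}$ let $h_I=|I|^{-1/2}(1_{I_l}-1_{I_r})$, where $I_l,I_r$ are the left and right halves of $I$. For a real sequence $\lambda=(\lambda_{IJ})_{I,J\in\mathcal{D}}$ define the bilinear form $$P_\lambda(f,g)=\sum_{I,J}\lambda_{IJ}\Big\langle f,h_I\otimes\frac{1_J}{|J|}\Big\rangle\Big\langle g,\frac{1_I}{|I|}\otimes h_J\Big\rangle$$ for $f\in\mathcal{A}$, $g\in\mathcal{B}$, where $\mathcal{A}$ (resp. $\mathcal{B}$) is the set of $f=\sum_{I,J}f_{IJ}h_I\otimes h_J\in L^2(\mathbb{R}^2)$ with $\|f\|_2=1$ such that $f_{IJ}\neq0$ for only finitely many $I$ (resp. only finitely many $J$); the sum defining $P_\lambda(f,g)$ is then finite. Set $\|P_\lambda\|_{2\to2}=\sup_{f\in\mathcal{A},\,g\in\mathcal{B}}|P_\lambda(f,g)|\in[0,\infty]$.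 $P_\lambda$ is unconditionally bounded if $\sup_\epsilon\|P_{\epsilon\lambda}\|_{2\to2}<\infty$, the supremum being over all sign sequences $\epsilon=(\epsilon_{IJ})$, $\epsilon_{IJ}=\pm1$, with $\epsilon\lambda=(\epsilon_{IJ}\lambda_{IJ})$. The BMO norms are $$\|\lambda\|_{\mathrm{BMO}_{\mathrm{rec}}}=\sup_{I_0,J_0\in\mathcal{D}}\Big(\frac{1}{|I_0\times J_0|}\sum_{I,J:\,I\times J\subset I_0\times J_0}|\lambda_{IJ}|^2\Big)^{1/2},\qquad \|\lambda\|_{\mathrm{BMO}_{\mathrm{prod}}}=\sup_{\Omega}\Big(\frac{1}{|\Omega|}\sum_{I,J:\,I\times J\subset\Omega}|\lambda_{IJ}|^2\Big)^{1/2},$$ where the second supremum is over nonempty sets $\Omega\subset\mathbb{R}^2$ with $|\Omega|<\infty$ such that every $x\in\Omega$ lies in some dyadic rectangle $I\times J\subset\Omega$. *)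

(* Defs.v *)
From HB Require Import structures.
From mathcomp Require Import all_boot all_order all_algebra.
From mathcomp Require Import finmap.
From mathcomp Require Import all_classical all_reals all_analysis.

Set Implicit Arguments.
Unset Strict Implicit.
Unset Printing Implicit Defensive.

Import Order.TTheory GRing.Theory Num.Theory.
Import numFieldNormedType.Exports.

Local Open Scope classical_set_scope.
Local Open Scope ring_scope.

(* The pair [(i, k)] stands for the dyadic interval [k 2^-i, (k+1) 2^-i); this
   is a bijection between [int * int] and the dyadic grid. *)
Definition dyadic : Type := (int * int)%type.

Definition dleft (I : dyadic) : dyadic := (I.1 + 1, 2 * I.2).
Definition dright (I : dyadic) : dyadic := (I.1 + 1, 2 * I.2 + 1).

Section BilinearParaproduct.
Context {R : realType}.

Definition plane : Type := (measurableTypeR R * measurableTypeR R)%type.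

Local Notation leb2 := (@lebesgue_measure R \x @lebesgue_measure R)%E.

Definition dlen (I : dyadic) : R := 2 ^ (- I.1).

Definition ditv (I : dyadic) : set R :=
  `[I.2%:~R * dlen I, (I.2 + 1)%:~R * dlen I[%classic.

Definition drect (I J : dyadic) : set plane := ditv I `*` ditv J.

Definition haar (I : dyadic) (x : R) : R :=
  (Num.sqrt (dlen I))^-1 * (\1_(ditv (dleft I)) x - \1_(ditv (dright I)) x).

Definition avg (I : dyadic) (x : R) : R := \1_(ditv I) x / dlen I.

Definition tensor (u v : R -> R) (z : plane) : R := u z.1 * v z.2.

Definition inner (f g : plane -> R) : R := \int[leb2]_z (f z * g z).

Definition L2norm (f : plane -> R) : \bar R :=
  ('N[leb2]_(2%:E) [EFin \o f])%E.

(* [f = sum_{I,J} c I J *: haar I (x) haar J], as the L^2 limit of the net of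
   finite partial sums. *)
Definition haar_expansion (c : dyadic -> dyadic -> R) (f : plane -> R) : Prop :=
  forall e : R, 0 < e ->
    exists F0 : {fset dyadic * dyadic},
      forall F : {fset dyadic * dyadic}, (F0 `<=` F)%fset ->
        (L2norm (fun z => (f z
           - \sum_(p <- F) c p.1 p.2 * tensor (haar p.1) (haar p.2) z)%R)
         < e%:E)%E.

Definition classA : set (plane -> R) :=
  [set f | [/\ f \in Lfun leb2 2%:E, L2norm f = 1%E
           & exists2 c : dyadic -> dyadic -> R, haar_expansion c f
             & finite_set [set I | exists J, c I J != 0]]].

Definition classB : set (plane -> R) :=
  [set g | [/\ g \in Lfun leb2 2%:E, L2norm g = 1%E
           & exists2 c : dyadic -> dyadic -> R, haar_expansion c g
             & finite_set [set J | exists I, c I J != 0]]].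

(* The sum over [setT] is a finitely supported one ([fsbigop]): for [f] in
   [classA] and [g] in [classB] only finitely many terms are nonzero. *)
Definition Pform (lam : dyadic -> dyadic -> R) (f g : plane -> R) : R :=
  \sum_(p \in [set: dyadic * dyadic])
     (lam p.1 p.2 * inner f (tensor (haar p.1) (avg p.2))
                  * inner g (tensor (avg p.1) (haar p.2))).

Definition Pnorm (lam : dyadic -> dyadic -> R) : \bar R :=
  ereal_sup [set `|Pform lam f g|%:E | f in classA & g in classB].

Definition sign_seq : set (dyadic -> dyadic -> R) :=
  [set eps | forall I J, eps I J = 1 \/ eps I J = -1].

Definition unconditionally_bounded (lam : dyadic -> dyadic -> R) : Prop :=
  (ereal_sup [set Pnorm (fun I J => (eps I J * lam I J)%R) | eps in sign_seq]
   < +oo)%E.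

(* The sum of [|lam I J|^2] over the dyadic rectangles contained in [Omega]. *)
Definition carleson_sum (lam : dyadic -> dyadic -> R) (Omega : set plane)
    : \bar R :=
  \esum_(p in [set p : dyadic * dyadic | drect p.1 p.2 `<=` Omega])
     (`|lam p.1 p.2| ^+ 2)%:E.

Definition BMOrec (lam : dyadic -> dyadic -> R) : \bar R :=
  ereal_sup [set sqrte (((dlen I0 * dlen J0)^-1)%:E
                        * carleson_sum lam (drect I0 J0))%E
            | I0 in [set: dyadic] & J0 in [set: dyadic]].

(* These sets are countable unions of rectangles, hence measurable, and have
   positive measure, so [fine (leb2 Omega)] is a positive real. *)
Definition dyadic_open : set (set plane) :=
  [set Omega | [/\ Omega !=set0, (leb2 Omega < +oo)%E
               & forall x, Omega x ->
                   exists I J, drect I J x /\ drect I J `<=` Omega]].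

Definition BMOprod (lam : dyadic -> dyadic -> R) : \bar R :=
  ereal_sup [set sqrte (((fine (leb2 Omega))^-1)%:E
                        * carleson_sum lam Omega)%E
            | Omega in dyadic_open].

End BilinearParaproduct.

(* Main.v *)
Require Import Defs.
From mathcomp Require Import all_boot all_order all_algebra.
From mathcomp Require Import all_classical all_reals all_analysis.
From mathcomp Require Import measurable_realfun.
From mathcomp Require Import ring lra zify.

(** The weight lambda_IJ = |I| when |I| = |J|, and 0 otherwise, works.

    Boundedness.  Write lambda_IJ = |I|^(1/2) |J|^(1/2) on the squares I x J and
    give one square root to each of the two coefficients.  The coefficient of f
    becomes the inner product of f with h_I (x) 1_J / |J|^(1/2), and that of g
    the inner product of g with 1_I / |I|^(1/2) (x) h_J.  Over all dyadic
    squares, each of these two families is orthonormal: if I <> I' the Haar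
    functions are orthogonal, while if I = I' then J and J' have the same length,
    so that they are equal or disjoint ([haar_avg_orthonormal],
    [avg_haar_orthonormal]).  Bessel's inequality ([bessel]) for the two families
    and |ab| <= (a^2 + b^2) / 2 bound the form by |f|^2 / 2 + |g|^2 / 2 = 1
    ([Pform_le1]).  Only absolute values of the coefficients enter, so the bound
    is the same for every choice of signs.

    Failure of BMO.  At each scale 2^-i the unit square is tiled by 4^i dyadic
    squares, each with lambda^2 = 4^-i.  So every scale i >= 0 contributes 1 to
    the Carleson sum over the unit square, which is therefore infinite
    ([carleson_sum_unit_square]).  This makes the rectangular norm infinite, and
    with it the larger product norm ([BMOrec_le_BMOprod]). *)

Set Implicit Arguments.
Unset Strict Implicit.
Unset Printing Implicit Defensive.

Import Order.TTheory GRing.Theory Num.Theory.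
Import numFieldNormedType.Exports.

Local Open Scope classical_set_scope.
Local Open Scope ring_scope.

(** * Integrals with a given value, and Bessel's inequality *)

Section HasIntegral.
Context d (T : measurableType d) (R : realType).
Variable mu : {measure set T -> \bar R}.
Implicit Types (f g : T -> R) (v w : R).

(** Integrability and the value of the integral are carried together because
    [Rintegral] is additive and homogeneous only on integrable functions. *)
Definition has_integral f v :=
  mu.-integrable setT (EFin \o f) /\ \int[mu]_x f x = v.

Lemma eq_has_integral g f v : f =1 g -> has_integral g v -> has_integral f v.
Proof. by move=> /funext ->. Qed.

Lemma has_integral_cst0 : has_integral (fun=> 0) 0.
Proof.
split; first exact: integrable0.
by rewrite Rintegral_cst// mul0r.
Qed.

Lemma has_integralZ a f v :
  has_integral f v -> has_integral (fun x => a * f x) (a * v).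
Proof.
move=> [If <-]; split; last by rewrite RintegralZl.
by have := integrableZl measurableT a If.
Qed.

Lemma has_integralD f g v w : has_integral f v -> has_integral g w ->
  has_integral (fun x => f x + g x) (v + w).
Proof.
move=> [If <-] [Ig <-]; split; last by rewrite RintegralD.
by have := integrableD measurableT If Ig.
Qed.

Lemma has_integral_indic (A : set T) v : measurable A -> mu A = v%:E ->
  has_integral (\1_A) v.
Proof.
move=> mA muA.
have E : (\int[mu]_x (\1_A x)%:E = v%:E)%E by rewrite integral_indic// setIT.
split; last by rewrite /Rintegral E.
apply/integrableP; split; first exact/measurable_EFinP.
rewrite (eq_integral (fun x => (\1_A x)%:E)) ?E ?ltry// => x _.
by rewrite gee0_abs// lee_fin.
Qed.

(** Induction on the family: removing from [f] its projection on the first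
    vector leaves the other coefficients unchanged, by orthogonality, and lowers
    the integral of [f ^+ 2] by exactly the square of the first coefficient. *)
Lemma bessel (I : eqType) (s : seq I) (phi : I -> T -> R) f v :
  uniq s ->
  {in s &, forall i j,
    has_integral (fun x => phi i x * phi j x) (i == j)%:R} ->
  {in s, forall i, mu.-integrable setT (EFin \o (fun x => f x * phi i x))} ->
  has_integral (fun x => f x * f x) v ->
  \sum_(i <- s) (\int[mu]_x (f x * phi i x)) ^+ 2 <= v.
Proof.
elim: s f v => [f v _ _ _ [_ <-]|i s IH f v].
  by rewrite big_nil; apply: Rintegral_ge0 => x _; rewrite -expr2 sqr_ge0.
move=> /= /andP[iNs us] ortho Ifphi Iff.
set c := \int[mu]_x (f x * phi i x).
have is_ : i \in i :: s by rewrite mem_head.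
have sub j : j \in s -> j \in i :: s by rewrite inE orbC => ->.
have Hi : has_integral (fun x => f x * phi i x) c by split=> //; exact: Ifphi.
(* Subtracting the projection of f on phi i does not affect the coefficient
   on phi j. *)
have Hj j : j \in s -> has_integral (fun x => (f x - c * phi i x) * phi j x)
    (\int[mu]_x (f x * phi j x)).
  move=> js.
  have h1 : has_integral (fun x => f x * phi j x) (\int[mu]_x (f x * phi j x)).
    by split=> //; apply: Ifphi; exact: sub.
  have h2 := ortho _ _ is_ (sub _ js).
  have := has_integralD h1 (has_integralZ (- c) h2).
  have -> : (i == j) = false by apply: contraNF iNs => /eqP ->.
  rewrite mulr0 addr0; apply: eq_has_integral => x; ring.
rewrite big_cons -lerBrDl.
under eq_big_seq => j js do rewrite -(Hj j js).2.
apply: IH => //.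
- by move=> j k js ks; apply: ortho; exact: sub.
- by move=> j js; exact: (Hj j js).1.
have := has_integralD (has_integralD Iff (has_integralZ (- (2 * c)) Hi))
  (has_integralZ (c ^+ 2) (ortho _ _ is_ is_)).
rewrite eqxx mulr1.
have -> : v + - (2 * c) * c + c ^+ 2 = v - c ^+ 2 by ring.
apply: eq_has_integral => x; ring.
Qed.

Lemma sqr_integrable_Lfun2 f : measurable_fun setT f ->
  mu.-integrable setT (EFin \o (fun x => f x * f x)) -> f \in Lfun mu 2%:E.
Proof.
move=> mf /integrableP[_ If]; rewrite inE; apply/andP; split; first by rewrite inE.
rewrite inE /= /finite_norm unlock; apply: poweR_lty.
rewrite (le_lt_trans _ If)// le_eqVlt; apply/orP; left; apply/eqP.
apply: eq_integral => x _ /=.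
by rewrite powR_mulrn// -normrX expr2.
Qed.

Lemma Lfun2_integrable_mul f g : f \in Lfun mu 2%:E -> g \in Lfun mu 2%:E ->
  mu.-integrable setT (EFin \o (fun x => f x * g x)).
Proof. by move=> Lf Lg; exact/Lfun1_integrable/Lfun2_mul_Lfun1. Qed.

Lemma Lfun2_unit_sqr f : f \in Lfun mu 2%:E -> ('N[mu]_(2%:E)[EFin \o f] = 1)%E ->
  has_integral (fun x => f x * f x) 1.
Proof.
move=> Lf Nf; split; first exact: Lfun2_integrable_mul.
have := @powR_Lnorm _ _ _ mu (EFin \o f) 2; rewrite Nf poweR_EFin powR1 pnatr_eq0 => /(_ isT) E.
rewrite /Rintegral -[RHS]/(fine 1%E) E; congr fine.
by apply: eq_integral => x _ /=; rewrite powR_mulrn// real_normK ?num_real.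
Qed.

End HasIntegral.

(** Fubini for a product of functions of one variable each: it reduces
    orthogonality in the plane to orthogonality on the line. *)
Lemma has_integral_prod d1 d2 (T1 : measurableType d1) (T2 : measurableType d2)
    (R : realType) (m1 : {sigma_finite_measure set T1 -> \bar R})
    (m2 : {sigma_finite_measure set T2 -> \bar R})
    (f : T1 -> R) (g : T2 -> R) (v w : R) :
  has_integral m1 f v -> has_integral m2 g w ->
  has_integral (m1 \x m2)%E (fun z : T1 * T2 => f z.1 * g z.2) (v * w).
Proof.
move=> [If <-] [Ig <-].
have mf : measurable_fun setT f by apply/measurable_EFinP; exact: measurable_int If.
have mg : measurable_fun setT g by apply/measurable_EFinP; exact: measurable_int Ig.
have mfg : measurable_fun setT (EFin \o (fun z : T1 * T2 => f z.1 * g z.2)).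
  apply/measurable_EFinP; apply: measurable_funM.
    exact: measurableT_comp mf measurable_fst.
  exact: measurableT_comp mg measurable_snd.
have fin_f : (\int[m1]_x (f x)%:E)%E \is a fin_num by exact: integrable_fin_num.
have fin_g : (\int[m2]_x (g x)%:E)%E \is a fin_num by exact: integrable_fin_num.
have Ifg : (m1 \x m2)%E.-integrable setT
    (EFin \o (fun z : T1 * T2 => f z.1 * g z.2)).
  apply/integrable12ltyP => //=.
  have Ig' := integrable_abse Ig.
  have E x : (\int[m2]_y `|(f x * g y)%:E|
      = (fine (\int[m2]_y `|(g y)%:E|))%:E * `|(f x)%:E|)%E.
    under eq_integral do rewrite /= normrM EFinM.
    by rewrite integralZl// muleC fineK// integrable_fin_num.
  under eq_integral do rewrite E.
  rewrite integralZl//; last exact: integrable_abse If.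
  apply: lte_mul_pinfty; rewrite ?lee_fin ?fine_ge0 ?integral_ge0//.
  by case/integrableP: If.
split => //.
rewrite /Rintegral -integral12_prod_meas1// -fineM//; congr fine.
have E x : (\int[m2]_y (f x * g y)%:E
    = (fine (\int[m2]_y (g y)%:E))%:E * (f x)%:E)%E.
  under eq_integral do rewrite EFinM.
  by rewrite integralZl// muleC fineK.
rewrite /fubini_F /=; under eq_integral do rewrite E.
by rewrite integralZl// fineK// muleC.
Qed.

(** * Orthogonality of Haar functions and of normalized indicators *)

Section Dyadic.
Context {R : realType}.
Implicit Types (I J : dyadic) (x y : R).
Local Notation leb := (@lebesgue_measure R).
Local Notation len I := (@dlen R I).
Local Notation itv I := (@ditv R I).

Lemma dlen_gt0 I : 0 < len I.
Proof. by rewrite exprz_gt0. Qed.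

Lemma dlen_neq0 I : len I != 0.
Proof. by rewrite gt_eqF// dlen_gt0. Qed.

Lemma dlen_dleft I : len (dleft I) = len I / 2.
Proof. by rewrite /dlen/= opprD expfzDr ?pnatr_eq0// exprN1. Qed.

Lemma dlen_dright I : len (dright I) = len I / 2.
Proof. exact: dlen_dleft. Qed.

(** Intervals of one length are the fibres of a single function of the point;
    disjointness and nestedness of dyadic intervals are read off from it. *)
Lemma mem_ditv I x : itv I x <-> Num.floor (x / len I) = I.2.
Proof.
rewrite /ditv/= in_itv/= -ler_pdivlMr ?dlen_gt0// -ltr_pdivrMr ?dlen_gt0//.
by split=> [/floor_def//|<-]; rewrite floor_itv ?num_real.
Qed.

Lemma measurable_ditv I : measurable (itv I).
Proof. exact: measurable_itv. Qed.

Lemma lebesgue_ditv I : leb (itv I) = (len I)%:E.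
Proof.
rewrite /ditv lebesgue_measure_itv/= lte_fin ltr_pM2r ?dlen_gt0// ltr_int ltrDl ltr01.
by rewrite -EFinB -mulrBl intrD addrAC subrr add0r mul1r.
Qed.

Lemma eq_dyadic_of_mem I J x : I.1 = J.1 -> itv I x -> itv J x -> I = J.
Proof.
case: I J => [i k] [j l] /= <-{j} /mem_ditv/= kE /mem_ditv/= lE.
by congr (_, _); rewrite -kE -lE.
Qed.

(** With |I| = 2^n |J|, belonging to I only constrains the integer part of
    z / |J|, which is the same for all z in J. *)
Lemma ditv_nested I J x y : (I.1 <= J.1)%R -> itv J x -> itv J y ->
  itv I x -> itv I y.
Proof.
move=> IJ /mem_ditv xJ /mem_ditv yJ.
pose n := `|J.1 - I.1|%N.
have lenE : len I = (2 ^+ n)%:~R * len J.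
  rewrite /dlen rmorphXn/= exprnP -expfzDr ?pnatr_eq0//; congr (_ ^ _).
  by rewrite /n gez0_abs ?subr_ge0// addrAC subrr add0r.
have E z : itv I z <->
    I.2 * 2 ^+ n <= Num.floor (z / len J) < (I.2 + 1) * 2 ^+ n.
  rewrite /ditv/= in_itv/= lenE !mulrA -!intrM.
  by rewrite -ler_pdivlMr ?dlen_gt0// -ltr_pdivrMr ?dlen_gt0// floor_ge_int floor_lt_int.
by move=> /E xI; apply/E; rewrite yJ -xJ.
Qed.

Lemma subset_dleft I : itv (dleft I) `<=` itv I.
Proof.
move=> x; rewrite /ditv/= !in_itv/= dlen_dleft !intrD intrM => /andP[lo hi].
have := dlen_gt0 I; move: lo hi; lra.
Qed.

Lemma subset_dright I : itv (dright I) `<=` itv I.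
Proof.
move=> x; rewrite /ditv/= !in_itv/= dlen_dright !intrD intrM => /andP[lo hi].
have := dlen_gt0 I; move: lo hi; lra.
Qed.

Lemma dleft_dright_disjoint I x :
  \1_(itv (dleft I)) x * \1_(itv (dright I)) x = 0 :> R.
Proof.
rewrite !indicE; case: (boolP (x \in itv (dleft I))); last by rewrite mul0r.
rewrite inE => xl; case: (boolP (x \in itv (dright I))); last by rewrite mulr0.
rewrite inE => xr.
by have [] := @eq_dyadic_of_mem (dleft I) (dright I) x erefl xl xr; lia.
Qed.

Lemma haar_out I x : ~ itv I x -> haar I x = 0.
Proof.
move=> xI; rewrite /haar !indicE !memNset ?subrr ?mulr0//.
  by move/subset_dright.
by move/subset_dleft.
Qed.

(** A shorter J is at most as long as the two halves of I, hence lies inside or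
    outside each of them. *)
Lemma haar_cst I J x y : (I.1 < J.1)%R -> itv J x -> itv J y ->
  haar I x = haar I y.
Proof.
move=> IJ xJ yJ; have IJ1 : (I.1 + 1 <= J.1)%R by lia.
have E K : (K.1 <= J.1)%R -> \1_(itv K) x = \1_(itv K) y :> R.
  move=> KJ; rewrite !indicE; suff -> : (x \in itv K) = (y \in itv K) by [].
  by apply/idP/idP; rewrite !inE; exact: (ditv_nested KJ).
by rewrite /haar !E.
Qed.

Lemma has_integral_ditv I : has_integral leb (\1_(itv I)) (len I).
Proof.
apply: has_integral_indic.
  exact: measurable_ditv.
exact: lebesgue_ditv.
Qed.

Lemma has_integral_haar I : has_integral leb (haar I) 0.
Proof.
have := has_integralZ (Num.sqrt (len I))^-1 (has_integralD
  (has_integral_ditv (dleft I)) (has_integralZ (-1) (has_integral_ditv (dright I)))).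
rewrite dlen_dleft dlen_dright mulN1r subrr mulr0.
by apply: eq_has_integral => x; rewrite /haar mulN1r.
Qed.

Lemma has_integral_haar_sqr I : has_integral leb (fun x => haar I x * haar I x) 1.
Proof.
have := has_integralZ (len I)^-1 (has_integralD
  (has_integral_ditv (dleft I)) (has_integral_ditv (dright I))).
rewrite dlen_dleft dlen_dright -splitr mulVf ?dlen_neq0//.
apply: eq_has_integral => x; rewrite /haar.
rewrite mulrACA -invfM -expr2 sqr_sqrtr ?ltW ?dlen_gt0//; congr (_ * _).
(* (1_l - 1_r)^2 = 1_l + 1_r because 1_l 1_r = 0. *)
have := dleft_dright_disjoint I x; rewrite !indicE.
by do 2 case: (x \in _) => /=; lra.
Qed.

(** [haar I] is constant on J, which supports [haar J], and [haar J] has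
    integral zero. *)
Lemma haar_ortho_lt I J : (I.1 < J.1)%R ->
  has_integral leb (fun x => haar I x * haar J x) 0.
Proof.
(* The left end of J represents the constant value of haar I on J. *)
move=> IJ; pose y : R := J.2%:~R * len J.
have yJ : itv J y.
  by rewrite /ditv/= in_itv/= lexx ltr_pM2r ?dlen_gt0// ltr_int ltrDl ltr01.
rewrite -(mulr0 (haar I y)).
apply: eq_has_integral (has_integralZ (haar I y) (has_integral_haar J)) => x.
have [xJ|xJ] := pselect (itv J x); first by rewrite (haar_cst IJ xJ yJ).
by rewrite (haar_out xJ) ?mulr0.
Qed.

Lemma haar_orthonormal I J :
  has_integral leb (fun x => haar I x * haar J x) (I == J)%:R.
Proof.
have [->|IJ] := eqVneq I J; first exact: has_integral_haar_sqr.
have [lt|gt|eq] := ltgtP I.1 J.1; first exact: haar_ortho_lt.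
  by apply: eq_has_integral (haar_ortho_lt gt) => x; rewrite mulrC.
apply: eq_has_integral (has_integral_cst0 _) => x.
have [xI|xI] := pselect (itv I x); last by rewrite haar_out ?mul0r.
rewrite (@haar_out J) ?mulr0// => xJ.
by rewrite (eq_dyadic_of_mem eq xI xJ) eqxx in IJ.
Qed.

(** This is the indicator of I divided by |I|^(1/2). *)
Definition unit_avg I x : R := Num.sqrt (len I) * avg I x.

Lemma unit_avgM I J x : unit_avg I x * unit_avg J x =
  (Num.sqrt (len I) * Num.sqrt (len J) / (len I * len J)) *
  \1_(itv I `&` itv J) x.
Proof. by rewrite /unit_avg /avg indicI/= invfM; ring. Qed.

(** For intervals of different lengths only the integrability of the product
    matters: its integral is multiplied by that of a product of two distinct
    Haar functions, which is zero. *)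
Lemma unit_avg_integrable I J : exists v,
  has_integral leb (fun x => unit_avg I x * unit_avg J x) v.
Proof.
have mIJ := measurableI _ _ (measurable_ditv I) (measurable_ditv J).
have fIJ : leb (itv I `&` itv J) \is a fin_num.
  rewrite ge0_fin_numE//; apply: (@le_lt_trans _ _ (leb (itv I))).
    by rewrite le_measure ?inE//; exact: measurable_ditv.
  by rewrite lebesgue_ditv ltry.
exists (Num.sqrt (len I) * Num.sqrt (len J) / (len I * len J)
    * fine (leb (itv I `&` itv J))).
apply: eq_has_integral => [x|]; first exact: unit_avgM.
by apply: has_integralZ; apply: has_integral_indic; rewrite ?fineK.
Qed.

Lemma unit_avg_orthonormal I J : I.1 = J.1 ->
  has_integral leb (fun x => unit_avg I x * unit_avg J x) (I == J)%:R.
Proof.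
move=> IJ; apply: eq_has_integral => [x|]; first exact: unit_avgM.
have [<-|nIJ] := eqVneq I J.
  have := has_integralZ (len I)^-1 (has_integral_ditv I).
  rewrite mulVf ?dlen_neq0//; apply: eq_has_integral => x.
  rewrite setIid -expr2 sqr_sqrtr ?ltW ?dlen_gt0//.
  by rewrite invfM mulrA mulfV ?dlen_neq0// mul1r.
apply: eq_has_integral (has_integral_cst0 _) => x.
rewrite indicE memNset ?mulr0// => -[xI xJ].
by rewrite (eq_dyadic_of_mem IJ xI xJ) eqxx in nIJ.
Qed.

End Dyadic.

(** * The form restricted to dyadic squares *)

Section Plane.
Context {R : realType}.
Implicit Types (I J : dyadic) (p q : dyadic * dyadic) (f g : @plane R -> R).
Local Notation leb2 := (@lebesgue_measure R \x @lebesgue_measure R)%E.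
Local Notation len I := (@dlen R I).

Definition same_scale p := p.1.1 == p.2.1.

Definition haar_avg p : @plane R -> R := tensor (haar p.1) (unit_avg p.2).
Definition avg_haar p : @plane R -> R := tensor (unit_avg p.1) (haar p.2).

(** When I = I', the condition |I| = |J| on both squares forces |J| = |J'|,
    which is where the restriction to squares is used: indicators of nested
    intervals of different lengths are not orthogonal. *)
Lemma haar_avg_orthonormal p q : same_scale p -> same_scale q ->
  has_integral leb2 (fun z => haar_avg p z * haar_avg q z) (p == q)%:R.
Proof.
case: p q => [I J] [I' J'] /eqP/= pE /eqP/= qE.
have [v Hv] : exists v, [/\ has_integral (@lebesgue_measure R)
    (fun x => unit_avg J x * unit_avg J' x) v
    & ((I, J) == (I', J'))%:R = (I == I')%:R * v].
  rewrite xpair_eqE; have [II|_] := eqVneq I I'.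
    exists (J == J')%:R; rewrite mul1r; split=> //.
    by apply: unit_avg_orthonormal; rewrite -pE -qE II.
  by have [v Hv] := @unit_avg_integrable R J J'; exists v; rewrite mul0r.
case: Hv => Hv ->.
apply: eq_has_integral (has_integral_prod (haar_orthonormal I I') Hv) => z.
by rewrite /haar_avg /tensor/=; ring.
Qed.

Lemma avg_haar_orthonormal p q : same_scale p -> same_scale q ->
  has_integral leb2 (fun z => avg_haar p z * avg_haar q z) (p == q)%:R.
Proof.
case: p q => [I J] [I' J'] /eqP/= pE /eqP/= qE.
have [v Hv] : exists v, [/\ has_integral (@lebesgue_measure R)
    (fun x => unit_avg I x * unit_avg I' x) v
    & ((I, J) == (I', J'))%:R = v * (J == J')%:R].
  rewrite xpair_eqE andbC; have [JJ|_] := eqVneq J J'.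
    exists (I == I')%:R; rewrite mulr1; split=> //.
    by apply: unit_avg_orthonormal; rewrite pE qE JJ.
  by have [v Hv] := @unit_avg_integrable R I I'; exists v; rewrite mulr0.
case: Hv => Hv ->.
apply: eq_has_integral (has_integral_prod Hv (haar_orthonormal J J')) => z.
by rewrite /avg_haar /tensor/=; ring.
Qed.

Lemma measurable_haar I : measurable_fun setT (@haar R I).
Proof.
by apply: measurable_funM => //; apply: measurable_funB;
  apply: measurable_indic; exact: measurable_ditv.
Qed.

Lemma measurable_unit_avg I : measurable_fun setT (@unit_avg R I).
Proof.
apply: measurable_funM => //; apply: measurable_funM => //.
by apply: measurable_indic; exact: measurable_ditv.
Qed.

Lemma measurable_tensor (u v : R -> R) : measurable_fun setT u ->
  measurable_fun setT v -> measurable_fun setT (tensor u v).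
Proof.
move=> mu mv; apply: measurable_funM.
  exact: measurableT_comp mu measurable_fst.
exact: measurableT_comp mv measurable_snd.
Qed.

Lemma haar_avg_Lfun2 p : same_scale p -> haar_avg p \in Lfun leb2 2%:E.
Proof.
move=> pp; apply: sqr_integrable_Lfun2; last exact: (haar_avg_orthonormal pp pp).1.
apply: measurable_tensor; [exact: measurable_haar|exact: measurable_unit_avg].
Qed.

Lemma avg_haar_Lfun2 p : same_scale p -> avg_haar p \in Lfun leb2 2%:E.
Proof.
move=> pp; apply: sqr_integrable_Lfun2; last exact: (avg_haar_orthonormal pp pp).1.
apply: measurable_tensor; [exact: measurable_unit_avg|exact: measurable_haar].
Qed.

(** Both factors are required to be square integrable because the integral of a
    non-integrable product has a junk value, which need not scale. *)
Lemma inner_scale f h k c : f \in Lfun leb2 2%:E -> k \in Lfun leb2 2%:E ->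
  (forall z, h z = c * k z) -> inner f h = c * inner f k.
Proof.
move=> Lf Lk hk; rewrite -(@has_integralZ _ _ _ leb2 c (fun z => f z * k z) _ _).2.
  by apply: eq_Rintegral => z _; rewrite hk mulrCA.
by split=> //; exact: Lfun2_integrable_mul.
Qed.

Lemma inner_haar_avg f I J : same_scale (I, J) -> f \in Lfun leb2 2%:E ->
  inner f (tensor (haar I) (avg J)) =
  (Num.sqrt (len J))^-1 * inner f (haar_avg (I, J)).
Proof.
move=> IJ Lf; apply: inner_scale => //; first exact: haar_avg_Lfun2.
move=> z; rewrite /haar_avg /tensor/= /unit_avg [RHS]mulrCA mulKf//.
by rewrite sqrtr_eq0 -ltNge dlen_gt0.
Qed.

Lemma inner_avg_haar f I J : same_scale (I, J) -> f \in Lfun leb2 2%:E ->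
  inner f (tensor (avg I) (haar J)) =
  (Num.sqrt (len I))^-1 * inner f (avg_haar (I, J)).
Proof.
move=> IJ Lf; apply: inner_scale => //; first exact: avg_haar_Lfun2.
move=> z; rewrite /avg_haar /tensor/= /unit_avg -[in RHS]mulrA mulKf//.
by rewrite sqrtr_eq0 -ltNge dlen_gt0.
Qed.

Definition same_scale_weight I J : R := if I.1 == J.1 then len I else 0.

(** The weight |I| = |I|^(1/2) |J|^(1/2) turns the two coefficients into
    coefficients in orthonormal families, to which Bessel's inequality applies.
    The hypothesis only concerns [`|lam I J|], so that it is stable under
    changes of sign. *)
Lemma Pform_le1 (lam : dyadic -> dyadic -> R) f g :
  (forall I J, `|lam I J| <= same_scale_weight I J) ->
  classA f -> classB g -> `|Pform lam f g| <= 1.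
Proof.
move=> lamle [Lf Nf _] [Lg Ng _].
(* A sum of infinite support is by convention the sum over the empty sequence,
   so that in all cases the sum runs over a duplicate-free sequence s. *)
rewrite /Pform; set s := finite_support _ _ _.
have us : uniq s by rewrite /s; case: finite_supportP => //= X *; exact: fset_uniq.
apply: (le_trans (ler_norm_sum _ _ _)).
pose t := [seq p <- s | same_scale p].
have ut : uniq t by exact: filter_uniq.
have tP p : p \in t -> same_scale p by rewrite mem_filter => /andP[].
have termle p : same_scale p ->
    `|lam p.1 p.2 * inner f (tensor (haar p.1) (avg p.2))
        * inner g (tensor (avg p.1) (haar p.2))|
    <= (inner f (haar_avg p) ^+ 2 + inner g (avg_haar p) ^+ 2) / 2.
  case: p => I J pp /=; rewrite inner_haar_avg// inner_avg_haar//.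
  set a := inner f _; set b := inner g _.
  have IJ : I.1 = J.1 by exact/eqP.
  have lenE : len J = len I by rewrite /dlen IJ.
  rewrite lenE; set r := Num.sqrt (len I).
  have -> : lam I J * (r^-1 * a) * (r^-1 * b) = lam I J / len I * (a * b).
    by rewrite -(@sqr_sqrtr _ (len I)) ?ltW ?dlen_gt0// -/r expr2 invfM; ring.
  rewrite normrM; apply: (@le_trans _ _ `|a * b|).
    rewrite ler_piMl// normrM normfV (gtr0_norm (dlen_gt0 I)).
    rewrite ler_pdivrMr ?dlen_gt0// mul1r (le_trans (lamle _ _))//.
    by rewrite /same_scale_weight IJ eqxx.
  rewrite ler_norml; have := sqr_ge0 (a + b); have := sqr_ge0 (a - b).
  by move=> h1 h2; apply/andP; split; nra.
rewrite (bigID same_scale)/= [X in _ + X]big1 ?addr0; last first.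
  move=> [I J] /negbTE np; suff -> : lam I J = 0 by rewrite !mul0r normr0.
  apply/eqP; rewrite -normr_le0 (le_trans (lamle _ _))//.
  by rewrite /same_scale_weight -/(same_scale (I, J)) np.
rewrite -big_filter -/t.
apply: (@le_trans _ _ (\sum_(p <- t)
    (inner f (haar_avg p) ^+ 2 + inner g (avg_haar p) ^+ 2) / 2)).
  by rewrite big_seq [leRHS]big_seq; apply: ler_sum => p /tP; exact: termle.
rewrite -mulr_suml big_split/=.
have bf : \sum_(p <- t) inner f (haar_avg p) ^+ 2 <= 1.
  apply: (@bessel _ _ _ leb2 _ t haar_avg f 1) => //.
  - by move=> p q /tP pp /tP qq; exact: haar_avg_orthonormal.
  - by move=> p /tP pp; apply: Lfun2_integrable_mul => //; exact: haar_avg_Lfun2.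
  - exact: Lfun2_unit_sqr.
have bg : \sum_(p <- t) inner g (avg_haar p) ^+ 2 <= 1.
  apply: (@bessel _ _ _ leb2 _ t avg_haar g 1) => //.
  - by move=> p q /tP pp /tP qq; exact: avg_haar_orthonormal.
  - by move=> p /tP pp; apply: Lfun2_integrable_mul => //; exact: avg_haar_Lfun2.
  - exact: Lfun2_unit_sqr.
by lra.
Qed.

Lemma Pnorm_le1 (lam : dyadic -> dyadic -> R) :
  (forall I J, `|lam I J| <= same_scale_weight I J) -> (Pnorm lam <= 1)%E.
Proof.
move=> lamle; apply: ge_ereal_sup => _ [f Af [g Bg <-]].
by rewrite lee_fin Pform_le1.
Qed.

Lemma same_scale_weight_ge0 I J : 0 <= same_scale_weight I J.
Proof. by rewrite /same_scale_weight; case: ifP => // _; rewrite ltW// dlen_gt0. Qed.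

(** * Failure of the Carleson condition on the unit square *)

(** A dyadic rectangle is one of the open sets of the product norm, with measure
    the product of its sides. *)
Lemma BMOrec_le_BMOprod (lam : dyadic -> dyadic -> R) :
  (BMOrec lam <= BMOprod lam)%E.
Proof.
apply: ge_ereal_sup => _ [I _ [J _ <-]].
have leb2E : leb2 (drect I J) = (len I * len J)%:E.
  rewrite /drect product_measure1E; [|exact: measurable_ditv|exact: measurable_ditv].
  by rewrite EFinM -!lebesgue_ditv.
apply: ereal_sup_ubound; exists (drect I J); last by rewrite leb2E.
split.
- exists (I.2%:~R * len I, J.2%:~R * len J); split => /=;
    by rewrite /ditv/= in_itv/= lexx ltr_pM2r ?dlen_gt0// ltr_int ltrDl ltr01.
- by rewrite leb2E ltry.
- by move=> x xIJ; exists I, J; split; last exact: subset_refl.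
Qed.

(** The squares of the first n scales inside the unit square contribute n. *)
Lemma carleson_sum_unit_square :
  carleson_sum same_scale_weight (@drect R (0, 0) (0, 0)) = +oo%E.
Proof.
apply/eqyP => A _.
pose n := (Num.truncn A).+1.
pose grid i := [seq (k, l) | k <- iota 0 (2 ^ i), l <- iota 0 (2 ^ i)].
pose square i (kl : nat * nat) : dyadic * dyadic :=
  ((i%:Z, kl.1%:Z), (i%:Z, kl.2%:Z)).
pose r := [seq square i kl | i <- iota 0 n, kl <- grid i].
have ur : uniq r.
  apply: allpairs_uniq_dep => [|i _|]; first exact: iota_uniq.
    by apply: allpairs_uniq; [exact: iota_uniq..|move=> [? ?] [? ?]].
  by move=> [i [k l]] [j [k' l']] _ _ [-> -> _ ->].
have sub_unit i k : (k < 2 ^ i)%N -> ditv (i%:Z, k%:Z) `<=` @ditv R (0, 0).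
  move=> ki x; have d0 := dlen_gt0 (R:=R) (i%:Z, 0).
  have dE : (2 ^ i)%:R * @dlen R (i%:Z, 0) = 1.
    by rewrite /dlen/= natrX -exprnN mulfV// expf_neq0// pnatr_eq0.
  rewrite /ditv/= !in_itv/= -[dlen (i%:Z, k%:Z)]/(dlen (i%:Z, 0)) => /andP[lo hi].
  rewrite {1 2}/dlen oppr0 expr0z mul0r add0r mulr1.
  rewrite (le_trans _ lo) ?mulr_ge0 ?ler0z// ?ltW//=.
  rewrite (lt_le_trans hi)// -[leRHS]dE ler_pM2r//.
  by rewrite -[(2 ^ i)%:R]/(((2 ^ i)%N%:Z)%:~R) ler_int lezD1 ltz_nat.
apply: esum_ge; exists [set` r].
  split; first exact: finite_seq.
  move=> _ /= /allpairsPdep[i [_ [_ /allpairsP[[k l] [ki li ->]] ->]]] /=.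
  rewrite !mem_iota !add0n !leq0n/= in ki li *.
  by move=> z [zk zl]; split; [exact: sub_unit zk|exact: sub_unit zl].
rewrite -fsbig_seq// sumEFin lee_fin big_allpairs_dep.
rewrite (eq_bigr (fun=> 1)) => [|i _].
  by rewrite big_const_seq count_predT size_iota iter_addr_0 ltW// truncnS_gt.
rewrite (eq_bigr (fun=> dlen (i%:Z, 0) ^+ 2)) => [|kl _]; last first.
  by rewrite /same_scale_weight eqxx ger0_norm// ltW// dlen_gt0.
rewrite big_const_seq count_predT size_allpairs !size_iota iter_addr_0.
(* The 4^i squares of side 2^-i have total weight 1. *)
rewrite -mulr_natl natrM -expr2 -exprMn /dlen/= natrX -exprnN.
by rewrite mulfV ?expr1n// expf_neq0// pnatr_eq0.
Qed.

End Plane.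

Theorem corollary1p4 (R : realType) :
  exists lam : dyadic -> dyadic -> R,
    [/\ forall I J : dyadic, 0 <= lam I J,
        BMOprod lam = +oo%E,
        BMOrec lam = +oo%E,
        (Pnorm lam < +oo)%E
      & unconditionally_bounded lam].
Proof.
have BMOrec_oo : BMOrec (@same_scale_weight R) = +oo%E.
  apply/eqP; rewrite -leye_eq; apply: ereal_sup_ubound.
  exists (0, 0) => //; exists (0, 0) => //.
  by rewrite carleson_sum_unit_square /dlen oppr0 expr0z mulr1 invr1 mul1e.
exists same_scale_weight; split.
- exact: same_scale_weight_ge0.
- by apply/eqP; rewrite -leye_eq -[leLHS]BMOrec_oo BMOrec_le_BMOprod.
- exact: BMOrec_oo.
- apply: (@le_lt_trans _ _ 1%E); last exact: ltry.
  by apply: Pnorm_le1 => I J; rewrite ger0_norm// same_scale_weight_ge0.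
- apply: (@le_lt_trans _ _ 1%E); last exact: ltry.
  apply: ge_ereal_sup => _ [eps epsP <-]; apply: Pnorm_le1 => I J.
  rewrite normrM (ger0_norm (same_scale_weight_ge0 I J)).
  by have [->|->] := epsP I J; rewrite ?normrN normr1 mul1r.
Qed.
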